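(* Let $n\ge 1$, let $\Lambda=(r_0,r_1,\dots,r_n)$ be a sequence of real numbers with $0=r_0<r_1<\cdots<r_n$, and for $t>0$ let $f_t(x)=t^x$. Let $\lambda=(\lambda_1,\dots,\lambda_n)$ be the real partition associated with $\Lambda$ and $\lambda^{(0)}=(\lambda_2,\dots,\lambda_n)$ its bottom partition. Then $$[r_0,r_1,\dots,r_n]f_t=\frac{(-1)^n}{r_1r_2\cdots r_n}\,(1-t)^n\,\frac{S_\lambda(1,t^{n})}{S_{\lambda^{(0)}}(t^{n})},$$ where inside $S$ the notation $t^{n}$ means that the argument $t$ is repeated $n$ times.
   Context: Divided differences: for pairwise distinct reals $x_0,\dots,x_m$, $[x_0,\dots,x_m]f=\sum_{i=0}^m \frac{f(x_i)}{\prod_{j\ne i}(x_i-x_j)}$. A real partition is a real tuple $\lambda=(\lambda_1,\dots,\lambda_n)$ with $\lambda_1>\lambda_2-1>\cdots>\lambda_n-(n-1)>-n$. The real partition associated with $\Lambda$ is $\lambda_k=r_n-r_{k-1}-(n-k+1)$, $k=1,\dots,n$. Schur functions: for positive, pairwise distinct $u_1,\dots,u_m$, $S_{(\lambda_1,\dots,\lambda_m)}(u_1,\dots,u_m)=\det(u_i^{\lambda_j+m-j})_{1\le i,j\le m}\big/\prod_{1\le i<j\le m}(u_i-u_j)$, extended by continuity to coinciding positive arguments. If there are more arguments than components of the partition, zeros are appended to the partition; the Schur function of the empty partition is $1$. *)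

(* Defs.v *)
From HB Require Import structures.
From mathcomp Require Import all_boot all_order all_algebra.
From mathcomp Require Import all_classical all_reals all_analysis.
From mathcomp Require Import lra.

Set Implicit Arguments.
Unset Strict Implicit.
Unset Printing Implicit Defensive.

Import Order.TTheory GRing.Theory Num.Theory.
Import numFieldNormedType.Exports.

Local Open Scope classical_set_scope.
Local Open Scope ring_scope.

Definition divided_difference (R : realType) (m : nat) (x : 'I_m.+1 -> R)
    (f : R -> R) : R :=
  \sum_(i < m.+1) f (x i) / \prod_(j < m.+1 | j != i) (x i - x j).

(* The components of a partition are numbered from 0: the usual lambda_k is
   lambda`_(k.-1). Since nth defaults to 0, the last inequality of the chain,
   lambda_n - (n - 1) > - n, is the case k = n.-1. *)
Definition real_partition (R : realType) (n : nat) (lambda : n.-tuple R) : Prop :=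
  forall k : nat, (k < n)%N -> lambda`_k - k%:R > lambda`_k.+1 - k.+1%:R.

Definition associated_partition (R : realType) (n : nat) (r : 'I_n.+1 -> R) :
    n.-tuple R :=
  [tuple r ord_max - r (widen_ord (leqnSn n) k) - (n - k)%:R | k < n].

Lemma associated_partitionP (R : realType) (n : nat) (r : 'I_n.+1 -> R) :
  (forall i j : 'I_n.+1, (i < j)%N -> r i < r j) ->
  real_partition (associated_partition r).
Proof.
move=> r_incr.
have E k (ltkn : (k < n.+1)%N) :
    (associated_partition r)`_k - k%:R = r ord_max - r (Ordinal ltkn) - n%:R.
  case: (ltnP k n) => [kn | nk].
    rewrite -(tnth_nth 0 _ (Ordinal kn)) tnth_mktuple /= natrB 1?ltnW //.
    have -> : widen_ord (leqnSn n) (Ordinal kn) = Ordinal ltkn by exact: val_inj.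
    lra.
  have kE : k = n by apply/eqP; rewrite eqn_leq nk -ltnS ltkn.
  rewrite nth_default ?size_tuple //.
  have -> : Ordinal ltkn = ord_max by exact: val_inj.
  rewrite kE; lra.
move=> k kn; rewrite (E k (ltnW kn)) (E k.+1 kn).
have := r_incr (Ordinal (ltnW kn : k < n.+1)%N) (Ordinal (kn : k.+1 < n.+1)%N) (ltnSn k).
lra.
Qed.

Definition bottom_partition (R : realType) (n : nat) (lambda : n.-tuple R) :
    n.-1.-tuple R :=
  behead_tuple lambda.

(* Meaningful for l <= m; the m - l missing components of lambda read as 0. *)
Definition schur_quotient (R : realType) (l : nat) (lambda : l.-tuple R)
    (m : nat) (u : 'rV[R]_m) : R :=
  \det (\matrix_(i < m, j < m) (u 0 i `^ (lambda`_j + (m - j.+1)%:R)))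
  / \prod_(i < m) \prod_(j < m | (i < j)%N) (u 0 i - u 0 j).

Definition positive_distinct (R : realType) (m : nat) : set 'rV[R]_m :=
  [set u | (forall i, 0 < u 0 i) /\ injective (u 0)].

(* At positive u with coinciding entries, the value is the limit of the
   quotient along points with positive, pairwise distinct entries. *)
Definition schur (R : realType) (l : nat) (lambda : l.-tuple R)
    (m : nat) (u : 'rV[R]_m) : R :=
  if injectiveb (u 0) then schur_quotient lambda u
  else lim (schur_quotient lambda v @[v --> within (@positive_distinct R m) (nbhs u)]).

(* Main.v *)
(* As all [v_i] tend to [t], row reduction by divided differences and the mean
   value theorem turn [det (v_i ^ a_j) / \prod_(i < j) (v_i - v_j)] into a
   multiple of the Wronskian of the powers [x ^ a_j] at [t], which is a
   Vandermonde determinant: the limit is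
   [kappa * t ^ (\sum_j a_j) * \prod_(i < j) (a_j - a_i)], where [kappa] is the
   same nonzero constant for all exponents [a]. With [a_j = r_n - r_j], this
   gives [S_lambda0 (t^n)], and expanding along the row of the argument 1 gives
   [(1 - t)^n S_lambda (1, t^n)] as an alternating sum of such limits with one
   [a_j] removed. Dividing, the Vandermonde products leave
   [t ^ r_j / \prod_(k != j) (r_j - r_k)], the terms of the divided difference.
   At [t = 1] both sides vanish. *)
Require Import Defs.
From HB Require Import structures.
From mathcomp Require Import all_boot all_order all_algebra.
From mathcomp Require Import all_classical all_reals all_analysis.
From mathcomp Require Import ring lra.

Set Implicit Arguments.
Unset Strict Implicit.
Unset Printing Implicit Defensive.

Import Order.TTheory GRing.Theory Num.Theory.
Import numFieldNormedType.Exports.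

Local Open Scope classical_set_scope.
Local Open Scope ring_scope.

(** * Mean value theorem for divided differences of powers *)

(** Rolle's theorem, [m] times. Functions [c * x ^ e + q] are closed under differentiation, so the
    induction varies [c], [e] and [q]; [0 <= a] keeps the points where powers are differentiable. *)
Lemma iterated_rolle_powR (R : realType) (m : nat) (a b c e : R)
    (q : {poly R}) (x : nat -> R) :
  0 <= a ->
  (forall k, (k <= m)%N -> a < x k < b) ->
  (forall k, (k < m)%N -> x k < x k.+1) ->
  (forall k, (k <= m)%N -> c * x k `^ e + q.[x k] = 0) ->
  exists2 y, a < y < b &
    c * \prod_(k < m) (e - k%:R) * y `^ (e - m%:R) + q^`(m).[y] = 0.
Proof.
move=> a0; elim: m c e q x => [|m IH] c e q x xab x_incr x0.
  by exists (x 0%N); [exact: xab | rewrite big_ord0 mulr1 subr0 derivn0 x0].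
pose f (y : R) : R := c * y `^ e + q.[y].
have df (y : R) : 0 < y -> is_derive y 1 f (c * (e * y `^ (e - 1)) + q^`().[y]).
  move=> y0; have dp := is_derive1_powR e y0.
  exact: (is_deriveD (is_deriveZ c dp) (is_derive_poly q y)).
(* Rolle on each gap. [choice] needs a value for every [k]; 0 is a dummy beyond the last gap. *)
have /choice[y xy] : forall k, exists y, (k <= m)%N ->
    x k < y < x k.+1 /\ c * e * y `^ (e - 1) + q^`().[y] = 0.
  move=> k; case: (leqP k m) => [km|_]; last by exists 0.
  have xk0 : 0 < x k.
    by apply: le_lt_trans a0 _; case/andP: (xab k (leqW km)).
  have [|||z] := @Rolle R f (x k) (x k.+1) (x_incr k km).
  - move=> z; rewrite in_itv/= => /andP[xz _].
    by apply: ex_derive; exact: df (lt_trans xk0 xz).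
  - apply: derivable_within_continuous => z; rewrite in_itv/= => /andP[xz _].
    by apply: ex_derive; exact: df (lt_le_trans xk0 xz).
  - by rewrite /f !x0// ltnW.
  rewrite in_itv/= => xz dz; exists z => _; split=> //.
  have z0 : 0 < z by case/andP: xz => xz _; exact: lt_trans xk0 xz.
  rewrite -mulrA -(@derive.derive_val _ _ _ _ _ _ _ (df z z0)).
  by rewrite derive.derive_val.
have [||z|z zab E] := IH (c * e) (e - 1) q^`() y _ _ _.
- move=> k km; have [/andP[xy1 xy2] _] := xy k km.
  have /andP[h1 _] := xab k (leqW km).
  have /andP[_ h2] := xab k.+1 km.
  by rewrite (lt_trans h1 xy1) (lt_trans xy2 h2).
- move=> k km; have [/andP[_ h] _] := xy k (ltnW km).
  by have [/andP[h' _] _] := xy k.+1 km; exact: lt_trans h h'.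
- by move=> km; case: (xy z km).
exists z => //; rewrite -[RHS]E derivSn big_ord_recl subr0.
congr (_ * _ `^ _ + _).
  rewrite -!mulrA; congr (_ * (_ * _)); apply: eq_bigr => k _.
  by rewrite lift0 -natr1; ring.
by rewrite -natr1; ring.
Qed.

(** The unnormalised Lagrange basis polynomials [l i] are monic of degree [m], so their weights
    [f (v i) / d i] add up to the coefficient of degree [m]. *)
Lemma lagrange_interpolation (R : realType) (m : nat) (v : 'I_m.+1 -> R)
    (f : R -> R) :
  injective v -> exists q : {poly R},
    [/\ (size q <= m.+1)%N, forall i, q.[v i] = f (v i) &
        q`_m = divided_difference v f].
Proof.
move=> v_inj.
pose l i := \prod_(j < m.+1 | j != i) ('X - (v j)%:P).
pose d i := \prod_(j < m.+1 | j != i) (v i - v j).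
pose q := \sum_(i < m.+1) (f (v i) / d i) *: l i.
have size_l i : size (l i) = m.+1.
  rewrite /l -big_filter size_prod_XsubC size_filter -sum1_count.
  by rewrite (sum1_card (predC1 i)) cardC1 card_ord.
have lead_l i : (l i)`_m = 1.
  have /monicP : l i \is monic by rewrite /l -big_filter monic_prod_XsubC.
  by rewrite /lead_coef size_l.
have d0 i : d i != 0.
  apply/prodf_neq0 => j ji; rewrite subr_eq0; apply/eqP => /v_inj ij.
  by rewrite ij eqxx in ji.
exists q; split=> [|i|].
- apply: (leq_trans (size_sum _ _ _)); apply/bigmax_leqP => i _.
  by rewrite (leq_trans (size_scale_leq _ _))// size_l.
- rewrite horner_sum (bigD1 i)//= big1 ?addr0 => [|j ji].
    rewrite hornerZ horner_prod (eq_bigr (fun j => v i - v j)).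
      by rewrite divfK.
    by move=> j _; rewrite !hornerE.
  rewrite hornerZ horner_prod (bigD1 i) 1?eq_sym//=.
  by rewrite hornerXsubC subrr mul0r mulr0.
- by rewrite coef_sum; apply: eq_bigr => i _; rewrite coefZ lead_l mulr1.
Qed.

(** By uniqueness the interpolant is the constant itself, with no term of degree [m > 0]. This
    serves the case [t = 1]. *)
Lemma divided_difference_cst (R : realType) (m : nat) (v : 'I_m.+1 -> R)
    (c : R) :
  (0 < m)%N -> injective v -> divided_difference v (fun=> c) = 0.
Proof.
move=> m0 v_inj.
have [q [size_q qv <-]] := lagrange_interpolation (fun=> c) v_inj.
suff /eqP : q - c%:P = 0.
  by rewrite subr_eq0 => /eqP ->; rewrite coefC gtn_eqF.
apply: (@roots_geq_poly_eq0 _ _ (codom v)).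
- by apply/allP => _ /codomP[i ->]; rewrite rootE !hornerE qv subrr.
- exact/injectiveP.
rewrite size_codom card_ord (leq_trans (size_polyD _ _))// geq_max size_q.
by rewrite size_polyN (leq_trans (size_polyC_leq1 _)).
Qed.

(** The interpolant [q] minus the power has [m + 1] zeros, and the [m]-th derivative of [q] is the
    constant [m! * q_m]. *)
Lemma divided_difference_powR_mvt (R : realType) (m : nat) (a b e : R)
    (v : 'I_m.+1 -> R) :
  0 <= a -> injective v -> (forall i, a < v i < b) ->
  exists2 y, a < y < b & divided_difference v (fun x => x `^ e) =
    \prod_(k < m) (e - k%:R) / m`!%:R * y `^ (e - m%:R).
Proof.
move=> a0 v_inj vab.
have [q [size_q qv qm]] := lagrange_interpolation (fun x => x `^ e) v_inj.
have dq : q^`(m) = (m`!%:R * q`_m)%:P.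
  apply/polyP => k; rewrite coef_derivn coefC; case: k => [|k].
    by rewrite addn0 ffactnn mulr_natl.
  by rewrite nth_default ?mul0rn// (leq_trans size_q)// addnS ltnS leq_addr.
pose s := sort <=%R (codom v).
have size_s : size s = m.+1 by rewrite size_sort size_codom card_ord.
have s_sorted : sorted <%R s.
  by rewrite lt_sorted_uniq_le sort_uniq sort_le_sorted andbT; exact/injectiveP.
have sP k : (k <= m)%N -> exists i, s`_k = v i.
  move=> km; have : s`_k \in s by rewrite mem_nth// size_s.
  by rewrite mem_sort => /codomP.
have [|||y yab] := @iterated_rolle_powR R m a b (-1) e q (nth 0 s) a0.
- by move=> k /sP[i ->].
- by move=> k km; apply: (sortedP _ s_sorted); rewrite size_s ltnS.
- by move=> k /sP[i ->]; rewrite qv mulN1r addNr.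
move=> E; exists y => //.
have {}E : m`!%:R * q`_m = \prod_(k < m) (e - k%:R) * y `^ (e - m%:R).
  by move/eqP: E; rewrite dq hornerC mulN1r mulNr addrC subr_eq0 => /eqP.
by rewrite -qm mulrAC -E mulrC mulKf// pnatr_eq0 -lt0n fact_gt0.
Qed.

(** * Limits as the nodes coalesce *)

Lemma cvg_det (R : realType) (T : Type) (F : set_system T) (FF : Filter F)
    (n : nat) (M : T -> 'M[R]_n) (L : 'M[R]_n) :
  (forall i j, M x i j @[x --> F] --> L i j) ->
  \det (M x) @[x --> F] --> \det L.
Proof.
move=> ML; apply: (cvg_big (@add_continuous _)) => s _.
by apply: cvgM; [exact: cvg_cst | exact: (cvg_big (@mul_continuous _))].
Qed.

(** The mean value point is squeezed to [t] along with the nodes, which are the coordinates of [v]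
    selected by [w]. *)
Lemma divided_difference_powR_cvg (R : realType) (m n : nat)
    (w : 'I_m.+1 -> 'I_n) (e t : R) :
  injective w -> 0 < t ->
  divided_difference (fun k => (v : 'rV[R]_n) 0 (w k)) (fun x => x `^ e)
    @[v --> within (@positive_distinct R n) (nbhs (const_mx t))]
  --> \prod_(k < m) (e - k%:R) / m`!%:R * t `^ (e - m%:R).
Proof.
move=> w_inj t0; apply/cvgrPdist_lt => eps eps0.
pose h (y : R) : R := \prod_(k < m) (e - k%:R) / m`!%:R * y `^ (e - m%:R).
have h_cont : h y @[y --> t] --> h t.
  have powR_cont : {for t, continuous (fun y : R => y `^ (e - m%:R))}.
    apply: differentiable_continuous; apply/derivable1_diffP.
    by have dp := is_derive1_powR (e - m%:R) t0; exact: ex_derive.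
  by apply: cvgM; [exact: cvg_cst | exact: powR_cont].
have /cvgrPdist_lt/(_ _ eps0)/nbhs_ballP[/= d d0 hd] := h_cont.
(* The bound by [t] keeps [t - d'] nonnegative, as the mean value theorem requires. *)
pose d' := Num.min d t.
have d'0 : 0 < d' by rewrite lt_min d0.
apply: filterS (nbhsx_ballx (const_mx t : 'rV[R]_n) d' d'0).
move=> v [_ vt] [_ v_inj].
have [||i|y /andP[ty yt] ->] :=
  @divided_difference_powR_mvt R m (t - d') (t + d') e (fun k => v 0 (w k)).
- by rewrite subr_ge0 ge_min lexx orbT.
- exact: inj_comp.
- by have := vt 0 (w i); rewrite mxE -ball_normE/= distrC ltr_distl.
apply: hd; rewrite -ball_normE/= distrC ltr_distl.
have d'd : d' <= d by rewrite ge_min lexx.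
by apply/andP; split; lra.
Qed.

(** * Alternants of real powers near a constant point *)

Definition vandermonde_prod (R : pzRingType) (n : nat) (a : 'I_n -> R) : R :=
  \prod_(i < n) \prod_(j < n | (i < j)%N) (a j - a i).

(** Row [i] evaluates a monic polynomial of degree [i] at the [a j], so the matrix is a
    unitriangular [C] times a Vandermonde matrix. *)
Lemma det_falling_powers (R : comNzRingType) (n : nat) (a : 'I_n -> R) :
  \det (\matrix_(i < n, j < n) \prod_(k < i) (a j - k%:R)) =
  vandermonde_prod a.
Proof.
pose p i : {poly R} := \prod_(k < i) ('X - (k%:R)%:P).
have size_p i : size (p i) = i.+1.
  by rewrite size_prod_XsubC /index_enum -enumT size_enum_ord.
pose C := \matrix_(i < n, k < n) (p i)`_k.
have -> : \matrix_(i < n, j < n) \prod_(k < i) (a j - k%:R) =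
    C *m Vandermonde n (\row_j a j).
  apply/matrixP => i j; rewrite !mxE.
  transitivity (p i).[a j].
    by rewrite horner_prod; apply: eq_bigr => k _; rewrite !hornerE.
  rewrite (@horner_coef_wide _ n) ?size_p//.
  by apply: eq_bigr => k _; rewrite !mxE.
have C_trig : is_trig_mx C.
  by apply/is_trig_mxP => i j ij; rewrite mxE nth_default// size_p.
rewrite det_mulmx det_Vandermonde (det_trig C_trig) /vandermonde_prod.
rewrite big1 ?mul1r => [|i _].
  by apply: eq_bigr => i _; apply: eq_bigr => j _; rewrite !mxE.
have /monicP : p i \is monic by exact: monic_prod_XsubC.
by rewrite mxE /lead_coef size_p.
Qed.

(** This is [schur_quotient] with free exponents, so that one exponent can be removed without
    leaving the family. *)
Definition power_quotient (R : realType) (n : nat) (a : 'I_n -> R)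
    (u : 'rV[R]_n) : R :=
  \det (\matrix_(i < n, j < n) (u 0 i `^ a j))
  / \prod_(i < n) \prod_(j < n | (i < j)%N) (u 0 i - u 0 j).

(* The lower triangular matrix [N] of divided difference weights turns row [i]
   of [(v_i ^ a_j)] into the divided differences at [v_0, .., v_i]; its
   determinant is the inverse of [\prod_(i < j) (v_j - v_i)], hence the sign. *)
Lemma power_quotient_divided_differences (R : realType) (n : nat)
    (a : 'I_n -> R) (v : 'rV[R]_n) :
  injective (v 0) ->
  power_quotient a v =
  (\prod_(i < n) \prod_(j < n | (i < j)%N) (-1))^-1 *
  \det (\matrix_(i < n, j < n)
    divided_difference (fun k : 'I_i.+1 => v 0 (widen_ord (ltn_ord i) k))
      (fun x => x `^ a j)).
Proof.
move=> v_inj.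
pose N : 'M[R]_n := \matrix_(i, k) if (k <= i)%N then
  (\prod_(l < n | (l != k) && (l < i.+1)%N) (v 0 k - v 0 l))^-1 else 0.
have -> : \matrix_(i < n, j < n)
    divided_difference (fun k : 'I_i.+1 => v 0 (widen_ord (ltn_ord i) k))
      (fun x => x `^ a j) = N *m \matrix_(i < n, j < n) (v 0 i `^ a j).
  apply/matrixP => i j; rewrite !mxE /divided_difference.
  rewrite (bigID (fun k : 'I_n => (k < i.+1)%N))/= [X in _ + X]big1 ?addr0.
    rewrite -[RHS]/(\sum_(k < n | true && (k < i.+1)%N) _).
    rewrite (big_ord_narrow_cond (ltn_ord i))/=; apply: eq_bigr => k _.
    rewrite !mxE/= -ltnS ltn_ord mulrC (big_ord_narrow_cond (ltn_ord i))/=.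
    by congr (_^-1 * _).
  by move=> k; rewrite !mxE ltnS => /negbTE ->; rewrite mul0r.
have N_trig : is_trig_mx N.
  by apply/is_trig_mxP => i k ik; rewrite mxE leqNgt ik.
rewrite det_mulmx (det_trig N_trig) mulrA mulrC; congr (_ * _).
rewrite /power_quotient [X in _ * X](eq_bigr (fun i : 'I_n =>
  (\prod_(l < n | (l < i)%N) (v 0 i - v 0 l))^-1)).
  rewrite prodfV -invfM; congr (_^-1).
  rewrite [X in _ = _ * X](exchange_big_dep predT)//= -big_split/=.
  apply: eq_bigr => i _; rewrite -big_split/=; apply: eq_bigr => j _.
  by rewrite mulN1r opprB.
move=> i _; rewrite mxE leqnn; congr (_^-1); apply: eq_bigl => l.
by rewrite ltnS [RHS]ltn_neqAle.
Qed.

(** [kappa] is chosen before [a] because it must cancel between limits for different exponents. *)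
Lemma power_quotient_cvg (R : realType) (n : nat) (t : R) :
  0 < t -> exists2 kappa : R, kappa != 0 & forall a : 'I_n -> R,
    power_quotient a v
      @[v --> within (@positive_distinct R n) (nbhs (const_mx t))]
    --> kappa * (t `^ (\sum_i a i) * vandermonde_prod a).
Proof.
move=> t0.
pose s : R := \prod_(i < n) \prod_(j < n | (i < j)%N) (-1).
pose c : R := \prod_(i < n) (i`!%:R * t `^ i%:R)^-1.
exists (s^-1 * c) => [|a].
  rewrite mulf_neq0 ?invr_eq0//.
    apply/prodf_neq0 => i _; apply/prodf_neq0 => j _.
    by rewrite oppr_eq0 oner_eq0.
  apply/prodf_neq0 => i _; rewrite invr_eq0; apply: mulf_neq0.
    by rewrite pnatr_eq0 -lt0n fact_gt0.
  by rewrite gt_eqF ?powR_gt0.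
pose L : 'M[R]_n := \matrix_(i, j)
  (\prod_(k < i) (a j - k%:R) / i`!%:R * t `^ (a j - i%:R)).
have -> : s^-1 * c * (t `^ (\sum_i a i) * vandermonde_prod a) = s^-1 * \det L.
  rewrite -mulrA; congr (_ * _).
  (* The row scaling does not involve [a] and goes into [kappa]; the column scaling yields the power
     of [t]. *)
  have -> : L = diag_mx (\row_i (i`!%:R * t `^ i%:R)^-1) *m
      (\matrix_(i < n, j < n) \prod_(k < i) (a j - k%:R)) *m
      diag_mx (\row_j (t `^ a j)).
    apply/matrixP => i j; rewrite mul_mx_diag mul_diag_mx !mxE.
    rewrite powRB ?(gt_eqF t0) ?implybT// invfM; ring.
  rewrite !det_mulmx !det_diag det_falling_powers.
  rewrite [X in X * _ * _](eq_bigr (fun i : 'I_n => (i`!%:R * t `^ i%:R)^-1));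
    last by move=> i _; rewrite mxE.
  rewrite [X in _ * _ * X](eq_bigr (fun i : 'I_n => t `^ a i));
    last by move=> i _; rewrite mxE.
  suff -> : t `^ (\sum_i a i) = \prod_i t `^ a i by rewrite /c mulrA mulrAC.
  apply: (big_morph (powR t)) => [x y|]; last exact: powRr0.
  by rewrite powRD// (gt_eqF t0) implybT.
pose D (v : 'rV[R]_n) := s^-1 * \det (\matrix_(i < n, j < n)
    divided_difference (fun k : 'I_i.+1 => v 0 (widen_ord (ltn_ord i) k))
      (fun x => x `^ a j)).
have: D v @[v --> within (@positive_distinct R n) (nbhs (const_mx t))]
    --> s^-1 * \det L.
  apply: cvgM; first exact: cvg_cst.
  apply: cvg_det => i j.
  rewrite [L i j]mxE; under eq_fun do rewrite mxE.
  apply: divided_difference_powR_cvg => // x y /(congr1 val)/= xy.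
  exact: val_inj.
apply: cvg_trans; apply: near_eq_cvg.
apply: filterS (withinT _ _) => v [_ v_inj].
  exact/esym/power_quotient_divided_differences.
Qed.

(** * Schur functions as limits *)

(** Shifting each entry [u 0 i] by [d * i] makes all entries distinct for small nonzero [d].
    Properness makes limits along this filter unique. *)
Lemma within_positive_distinct_proper (R : realType) (n : nat) (u : 'rV[R]_n) :
  (forall i, 0 < u 0 i) ->
  ProperFilter (within (@positive_distinct R n) (nbhs u)).
Proof.
move=> u0; split; last exact: within_filter.
move=> /nbhs_ballP[eps /= eps0 uD].
pose g (d : R) : 'rV[R]_n := \row_i (u 0 i + d * i%:R).
have g_cvg i : g d 0 i @[d --> 0^'] --> u 0 i.
  under eq_fun do rewrite mxE.
  have : u 0 i + d * i%:R @[d --> 0^'] --> u 0 i + 0 * i%:R.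
    apply: cvg_within_filter; apply: cvgD; first exact: cvg_cst.
    by apply: cvgM; [exact: cvg_id | exact: cvg_cst].
  by rewrite mul0r addr0.
have g_near : \forall d \near 0^', forall i,
    `|u 0 i - g d 0 i| < Num.min eps (u 0 i).
  apply: filter_forall => i.
  by have /cvgrPdist_lt := g_cvg i; apply; rewrite lt_min eps0 u0.
have g_inj : \forall d \near 0^', forall i j, i != j -> g d 0 i != g d 0 j.
  apply: filter_forall => i; apply: filter_forall => j.
  have [->|ij] := eqVneq i j; first exact: nearW.
  have [uij|uij] := eqVneq (u 0 i) (u 0 j).
    apply: filterS (nbhs_dnbhs_neq 0) => d d0 _; rewrite !mxE uij.
    by rewrite (inj_eq (addrI _)) (inj_eq (mulfI d0)) eqr_nat.
  have gij : (g d 0 i - g d 0 j) @[d --> 0^'] --> u 0 i - u 0 j.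
    exact: cvgB.
  have uij0 : u 0 i - u 0 j != 0 by rewrite subr_eq0.
  apply: (filterS _ (cvgr_neq0 _ gij uij0)) => d gd _.
  by rewrite -subr_eq0.
have [d [gd1 gd2]] := @filter_ex _ _ (Proper_dnbhs_numFieldType (0 : R)) _
  (filterI g_near g_inj).
apply: (uD (g d)).
  split=> // i j; rewrite (ord1 i) -ball_normE/=.
  by apply: lt_le_trans (gd1 j) _; rewrite ge_min lexx.
split=> [i|i j /eqP gij]; last by apply: contraTeq gij; exact: gd2.
have : `|u 0 i - g d 0 i| < u 0 i.
  by apply: lt_le_trans (gd1 i) _; rewrite ge_min lexx orbT.
by rewrite ltr_distlC subrr => /andP[].
Qed.

(** If the entries of [u] are distinct, [u] itself lies in every set of the filter, so the limit is
    the value there; otherwise limits are unique. *)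
Lemma schur_eq (R : realType) (l : nat) (lambda : l.-tuple R) (n : nat)
    (u : 'rV[R]_n) (L : R) :
  (forall i, 0 < u 0 i) ->
  schur_quotient lambda v @[v --> within (@positive_distinct R n) (nbhs u)]
    --> L ->
  schur lambda u = L.
Proof.
move=> u0 uL; rewrite /schur; case: ifPn => [/injectiveP u_inj|_].
  apply/eqP/negPn/negP; rewrite eq_sym -subr_eq0 -normr_gt0 => d0.
  have /cvgrPdist_lt/(_ _ d0)/nbhs_singleton := uL.
  by move=> /(_ (conj u0 u_inj)); rewrite ltxx.
have uF := within_positive_distinct_proper u0.
exact: cvg_lim.
Qed.

(** * Expansion along the first row *)

Lemma power_quotient_row (R : realType) (n : nat) (a : 'I_n.+1 -> R)
    (v : 'rV[R]_n.+1) :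
  power_quotient a v =
  (\prod_(k < n) (v 0 ord0 - v 0 (lift ord0 k)))^-1 *
  \sum_(j < n.+1) (-1) ^+ j * v 0 ord0 `^ a j *
    power_quotient (fun k : 'I_n => a (lift j k)) (\row_k v 0 (lift ord0 k)).
Proof.
rewrite /power_quotient big_ord_recl.
have -> : \prod_(j < n.+1 | ((ord0 : 'I_n.+1) < j)%N) (v 0 ord0 - v 0 j) =
    \prod_(k < n) (v 0 ord0 - v 0 (lift ord0 k)).
  by rewrite [LHS]big_mkcond [LHS]big_ord_recl/= mul1r.
have -> : \prod_(i < n) \prod_(j < n.+1 | (lift ord0 i < j)%N)
      (v 0 (lift ord0 i) - v 0 j) =
    \prod_(i < n) \prod_(j < n | (i < j)%N)
      ((\row_k v 0 (lift ord0 k) : 'rV_n) 0 i -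
       (\row_k v 0 (lift ord0 k) : 'rV_n) 0 j).
  apply: eq_bigr => i _; rewrite [LHS]big_mkcond [LHS]big_ord_recl/= mul1r.
  by rewrite [RHS]big_mkcond; apply: eq_bigr => j _; rewrite !mxE.
rewrite (expand_det_row _ ord0) invfM mulrC -mulrA; congr (_ * _).
rewrite mulr_sumr; apply: eq_bigr => j _.
rewrite mxE /cofactor add0n mulrC -!mulrA [RHS]mulrCA; congr (_ * _).
congr (_ * (_ * _)); congr (\det _).
by apply/matrixP => i k; rewrite !mxE.
Qed.

(** Pass to the limit in the row expansion: as [s != t], the factors taken out of the denominator
    have the nonzero limit [(s - t) ^ n]. *)
Lemma power_quotient_row_cvg (R : realType) (n : nat) (a : 'I_n.+1 -> R)
    (s t : R) (L : 'I_n.+1 -> R) :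
  0 < s -> s != t ->
  (forall j : 'I_n.+1, power_quotient (fun k : 'I_n => a (lift j k)) v
    @[v --> within (@positive_distinct R n) (nbhs (const_mx t))] --> L j) ->
  power_quotient a v @[v --> within (@positive_distinct R n.+1)
    (nbhs (row_mx (const_mx s : 'rV[R]_1) (const_mx t : 'rV[R]_n)))]
  --> (s - t) ^- n * \sum_(j < n.+1) (-1) ^+ j * s `^ a j * L j.
Proof.
move=> s0 st aL; set u := row_mx _ _.
have u_head : u 0 ord0 = s.
  have -> : (ord0 : 'I_n.+1) = lshift n (ord0 : 'I_1) by exact: val_inj.
  by rewrite /u row_mxEl mxE.
have u_tail k : u 0 (lift ord0 k) = t.
  have -> : lift (ord0 : 'I_n.+1) k = rshift 1 k by exact: val_inj.
  by rewrite /u row_mxEr mxE.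
have u_cvg i : (v : 'rV[R]_n.+1) 0 i
    @[v --> within (@positive_distinct R n.+1) (nbhs u)] --> u 0 i.
  by apply: cvg_within_filter; exact: coord_continuous.
(* Dropping the first coordinate keeps the entries positive and distinct, so the tail converges
   along the restricted filter. *)
have tail_cvg : (\row_k (v : 'rV[R]_n.+1) 0 (lift ord0 k) : 'rV[R]_n)
    @[v --> within (@positive_distinct R n.+1) (nbhs u)]
    --> within (@positive_distinct R n) (nbhs (const_mx t)).
  move=> P /nbhs_ballP[eps /= eps0 tP].
  apply/nbhs_ballP; exists eps => // v [_ uv] [v0 v_inj]; apply: tP.
    split=> // i k; rewrite !mxE; have := uv 0 (lift ord0 k).
    by rewrite u_tail.
  split=> [k|k k']; rewrite !mxE//.
  by move=> /v_inj /lift_inj.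
rewrite (_ : power_quotient a = fun v =>
    (\prod_(k < n) (v 0 ord0 - v 0 (lift ord0 k)))^-1 *
    \sum_(j < n.+1) (-1) ^+ j * v 0 ord0 `^ a j *
      power_quotient (fun k : 'I_n => a (lift j k)) (\row_k v 0 (lift ord0 k)));
  last by apply/funext => v; exact: power_quotient_row.
apply: cvgM.
  apply: cvgV; first by rewrite expf_neq0// subr_eq0.
  rewrite -[X in _ ^+ X](card_ord n) -prodr_const.
  apply: (cvg_big (@mul_continuous _)) => k _.
  by rewrite -u_head -(u_tail k); exact: cvgB.
apply: (cvg_big (@add_continuous _)) => j _.
apply: cvgM; last exact: cvg_comp tail_cvg (aL j).
apply: cvgM; first exact: cvg_cst.
have powR_cont : {for u 0 ord0, continuous (fun y : R => y `^ a j)}.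
  apply: differentiable_continuous; apply/derivable1_diffP.
  rewrite u_head; have dp := is_derive1_powR (a j) s0; exact: ex_derive.
rewrite -u_head; exact: cvg_comp (u_cvg ord0) powR_cont.
Qed.

(** The factors involving [a j] are split off; the [j] of them with [k < j] occur as [a j - a k],
    whence the sign. *)
Lemma vandermonde_prod_lift (R : comNzRingType) (n : nat) (a : 'I_n.+1 -> R)
    (j : 'I_n.+1) :
  vandermonde_prod a = (-1) ^+ j * \prod_(k < n.+1 | k != j) (a k - a j) *
    vandermonde_prod (fun k : 'I_n => a (lift j k)).
Proof.
have -> : (-1) ^+ j = \prod_(k < n) (if (lift j k < j)%N then -1 else 1) :> R.
  have <- : \prod_(i < n.+1 | (i < j)%N) (-1) = (-1) ^+ j :> R.
    by rewrite (big_ord_narrow (ltnW (ltn_ord j))) prodr_const card_ord.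
  by rewrite big_mkcond (bigD1_ord j)//= ltnn mul1r.
rewrite [\prod_(k < _ | _ != _) _]big_mkcond (bigD1_ord j)//= eqxx mul1r.
rewrite /vandermonde_prod (bigD1_ord j)//= big_mkcond (bigD1_ord j)//= ltnn.
rewrite mul1r.
have -> : \prod_(i < n) \prod_(i' < n.+1 | (lift j i < i')%N)
      (a i' - a (lift j i)) =
    \prod_(i < n) ((if (lift j i < j)%N then a j - a (lift j i) else 1) *
      \prod_(k < n | (i < k)%N) (a (lift j k) - a (lift j i))).
  apply: eq_bigr => i _; rewrite big_mkcond (bigD1_ord j)//=; congr (_ * _).
  rewrite [RHS]big_mkcond; apply: eq_bigr => k _.
  by rewrite !ltnNge leq_bump2.
rewrite [in LHS]big_split/= mulrA -!big_split/=.
apply: eq_bigr => k _; congr (_ * _).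
rewrite eq_sym neq_lift -[bump j k]/(nat_of_ord (lift j k)).
case: ltngtP => [_|_|/val_inj jk]; [ring | ring |].
by have := neq_lift j k; rewrite -jk eqxx.
Qed.

Lemma schur_power_quotient_cvg (R : realType) (l : nat) (lambda : l.-tuple R)
    (n : nat) (a : 'I_n -> R) (u : 'rV[R]_n) (L : R) :
  (forall i, 0 < u 0 i) ->
  (forall j : 'I_n, lambda`_j + (n - j.+1)%:R = a j) ->
  power_quotient a v @[v --> within (@positive_distinct R n) (nbhs u)]
    --> L ->
  schur lambda u = L.
Proof.
move=> u0 /funext <- uL; exact: schur_eq.
Qed.

(** These are the exponents of [schur lambda] at [n + 1] arguments. For [j = n] the default 0 of
    [nth] is the zero appended to the partition. *)
Lemma associated_partition_exponent (R : realType) (n : nat)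
    (r : 'I_n.+1 -> R) (j : 'I_n.+1) :
  (associated_partition r)`_j + (n - j)%:R = r ord_max - r j.
Proof.
have [jn|nj] := ltnP j n.
  rewrite -(tnth_nth 0 _ (Ordinal jn)) tnth_mktuple/= subrK.
  by congr (_ - r _); exact: val_inj.
have -> : j = ord_max.
  by apply/val_inj/eqP; rewrite /= eqn_leq nj -ltnS ltn_ord.
by rewrite nth_default ?size_tuple// subnn subrr addr0.
Qed.

(** * Comparison of the Schur quotient with the divided difference *)

Theorem corollary1 (R : realType) (n : nat) (hn : (1 <= n)%N)
    (r : 'I_n.+1 -> R) (r0 : r ord0 = 0)
    (r_incr : forall i j : 'I_n.+1, (i < j)%N -> r i < r j)
    (t : R) (ht : 0 < t) :
  let lambda := associated_partition r in
  let lambda0 := bottom_partition lambda in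
  divided_difference r (fun x => t `^ x) =
    (-1) ^+ n / (\prod_(i < n.+1 | i != ord0) r i) * (1 - t) ^+ n *
    (schur lambda (row_mx (const_mx 1 : 'rV[R]_1) (const_mx t : 'rV[R]_n))
     / schur lambda0 (const_mx t : 'rV[R]_n)).
Proof.
move=> lambda lambda0.
have r_inj : injective r.
  move=> i j rij; apply: val_inj; case: (ltngtP i j) => // /r_incr.
    by rewrite rij ltxx.
  by rewrite rij ltxx.
have [t1|t1] := eqVneq 1 t.
  rewrite -t1 subrr expr0n gtn_eqF// mulr0 mul0r.
  rewrite (_ : (fun _ => _) = fun=> 1) ?divided_difference_cst//.
  by apply/funext => x; rewrite powR1.
pose a (j : 'I_n.+1) := r ord_max - r j.
have [kappa kappa0 kappaP] := power_quotient_cvg n ht.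
pose L (j : 'I_n.+1) := kappa * (t `^ (\sum_(k < n) a (lift j k)) *
  vandermonde_prod (fun k : 'I_n => a (lift j k))).
(* [lambda0] has [n - 1] components for [n] arguments; with the appended zero its exponents are [a]
   without [a ord0]. *)
have -> : schur lambda0 (const_mx t : 'rV[R]_n) = L ord0.
  apply: schur_power_quotient_cvg (kappaP _) => [i|k]; first by rewrite mxE.
  by rewrite /a -associated_partition_exponent nth_behead.
have -> : schur lambda
    (row_mx (const_mx 1 : 'rV[R]_1) (const_mx t : 'rV[R]_n)) =
    (1 - t) ^- n * \sum_(j < n.+1) (-1) ^+ j * 1 `^ a j * L j.
  apply: (@schur_power_quotient_cvg _ _ _ n.+1 a) => [i|j|].
  - by rewrite mxE; case: splitP => k _; rewrite mxE.
  - by rewrite subSS associated_partition_exponent.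
  - exact: power_quotient_row_cvg.
pose d (j : 'I_n.+1) := \prod_(k < n.+1 | k != j) (r j - r k).
pose W (j : 'I_n.+1) := vandermonde_prod (fun k : 'I_n => a (lift j k)).
have d_neq0 (j : 'I_n.+1) : d j != 0.
  apply/prodf_neq0 => k; apply: contra; rewrite subr_eq0 eq_sym.
  by rewrite (inj_eq r_inj).
(* Splitting the same product at each [j] relates every [W j] to [W ord0]. *)
have WE (j : 'I_n.+1) : vandermonde_prod a = (-1) ^+ j * d j * W j.
  rewrite (vandermonde_prod_lift a j); congr (_ * _ * _).
  by apply: eq_bigr => k _; rewrite /a; ring.
have W_neq0 (j : 'I_n.+1) : W j != 0.
  apply/prodf_neq0 => i _; apply/prodf_neq0 => k ik.
  rewrite subr_eq0; apply/eqP => /addrI/oppr_inj/r_inj/lift_inj ki.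
  by rewrite ki ltnn in ik.
(* As [r ord0 = 0], the factors of [d ord0] are the [- r k]. *)
have -> : (-1) ^+ n / \prod_(i < n.+1 | i != ord0) r i = (d ord0)^-1.
  rewrite -[(-1) ^+ n]invr_sign -invfM; congr (_^-1).
  rewrite /d [RHS](eq_bigr (fun k => -1 * r k)); last first.
    by move=> k _; rewrite r0; ring.
  rewrite big_split/=; congr (_ * _).
  by rewrite prodr_const cardC1 card_ord.
rewrite /divided_difference -mulrA [X in _ * X]mulrA [X in _ * (X * _)]mulrA.
rewrite mulfV ?mul1r; last by rewrite expf_neq0// subr_eq0.
rewrite mulr_suml mulr_sumr; apply: eq_bigr => j _.
(* Removing [a j] instead of [a ord0] raises the sum of the exponents by [a ord0 - a j = r j]. *)
have -> : L j = kappa * (t `^ (\sum_(k < n) a (lift ord0 k)) * t `^ r j * W j).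
  congr (_ * (_ * _)); rewrite -powRD; last by rewrite (gt_eqF ht) implybT.
  have := bigD1_ord ord0 (erefl true) : \sum_(k < n.+1) a k = _.
  rewrite (bigD1_ord j)//= {1 3}/a r0 => E; congr (_ `^ _); lra.
rewrite /L -/(W ord0) powR1 mulr1.
have := WE j; rewrite (WE ord0) expr0 mul1r => E.
have T0 : t `^ (\sum_(k < n) a (lift ord0 k)) != 0 by rewrite gt_eqF ?powR_gt0.
rewrite -/(d j).
apply: (mulIf (d_neq0 j)); rewrite divfK//.
(* The inserted fraction equals 1 by [E]. *)
transitivity (t `^ r j * ((-1) ^+ j * d j * W j) / (d ord0 * W ord0)).
  by rewrite -E mulfK// mulf_neq0.
field.
by rewrite d_neq0 W_neq0 kappa0 T0.
Qed.
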